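(* Consider the disordered monomer-dimer model on a finite graph $G$ with maximum degree at most $D$. Assume that the edge weights are i.i.d. standard Gaussians and the vertex weights are i.i.d. from any distribution (independent of the edge weights). Then there exists a constant $c>0$, depending only on $D$ and the vertex weight distribution, such that $$\mathrm{Var}(\langle|\mathsf{M}_G|\rangle)\ge c|E(G)|.$$
   Context: Let $G=(V(G),E(G))$ be a finite graph. A (partial) matching of $G$ is a set of edges of $G$ no two of which share a vertex; $\mathcal{M}_G$ is the set of all matchings of $G$ (including the empty one). For $x\in V(G)$ and $M\in\mathcal{M}_G$, $x\notin M$ means that $x$ is not an endpoint of any edge of $M$ (it is unmatched). The edges carry i.i.d. real weights $(w_e)_{e\in E(G)}$ and the vertices carry i.i.d. real weights $(\nu_x)_{x\in V(G)}$; the edge weights are independent of the vertex weights. The disordered monomer-dimer model on $G$ (with inverse temperature normalized to $1$) is the random Gibbs measure $\mu_G(M)=Z_G^{-1}\exp(\sum_{e\in M}w_e+\sum_{x\notin M}\nu_x)$, $M\in\mathcal{M}_G$, where $Z_G$ is the normalizing constant. $\mathsf{M}_G$ denotes a random matching sampled from $\mu_G$ given the weights, $|\mathsf{M}_G|$ its number of edges, and $\langle\cdot\rangle$ the Gibbs expectation with respect to $\mu_G$ (for fixed weights). $\mathrm{Var}$ refers to the randomness of the weights. *)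

(* Defs.v *)
From HB Require Import structures.
From mathcomp Require Import all_boot all_order all_algebra.
From mathcomp Require Import all_classical all_reals all_analysis.

Set Implicit Arguments.
Unset Strict Implicit.
Unset Printing Implicit Defensive.

Import Order.TTheory GRing.Theory Num.Theory.
Local Open Scope classical_set_scope.
Local Open Scope ring_scope.

Record sgraph := SGraph {
  vertex :> finType;
  adj : rel vertex;
  adj_sym : symmetric adj;
  adj_irr : irreflexive adj }.

(* An edge is the two-element set of its endpoints. *)
Definition edge_set (G : sgraph) : {set {set G}} :=
  [set [set p.1; p.2]%SET | p in [pred p : G * G | adj p.1 p.2]]%SET.

Definition edge (G : sgraph) : finType := {A : {set G} | A \in edge_set G}.

Definition degree (G : sgraph) (x : G) : nat := #|[set y | adj x y]%SET|.

Definition matchings (G : sgraph) : {set {set edge G}} :=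
  [set M : {set edge G} |
    [forall a in M, forall b in M, (a != b) ==> [disjoint val a & val b]]]%SET.

Definition unmatched (G : sgraph) (M : {set edge G}) : {set G} :=
  [set x | [forall a in M, x \notin val a]]%SET.

Section gibbs.
Variables (R : realType) (G : sgraph) (w : edge G -> R) (nu : G -> R).

Definition boltzmann (M : {set edge G}) : R :=
  expR (\sum_(a in M) w a + \sum_(x in unmatched M) nu x).

Definition partition_function : R := \sum_(M in matchings G) boltzmann M.

Definition gibbs (M : {set edge G}) : R := boltzmann M / partition_function.

Definition gibbs_expectation (f : {set edge G} -> R) : R :=
  \sum_(M in matchings G) gibbs M * f M.

End gibbs.

Section random_families.
Context d (T : measurableType d) (R : realType) (P : probability T R).

(* J ranges over all subfamilies, which are finite since I is. *)
Definition mutually_independent (I : finType) (X : I -> {RV P >-> R}) : Prop :=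
  forall (J : {set I}) (A : I -> set R), (forall i, measurable (A i)) ->
    P (\bigcap_(i in [set` J]) (X i @^-1` A i))
    = (\prod_(i in J) P (X i @^-1` A i))%E.

Definition has_law (X : {RV P >-> R}) (rho : set R -> \bar R) : Prop :=
  forall A : set R, measurable A -> distribution P X A = rho A.

Definition iid (I : finType) (X : I -> {RV P >-> R})
    (rho : set R -> \bar R) : Prop :=
  mutually_independent X /\ forall i, has_law (X i) rho.

(* The sigma-algebra generated by all the variables of the family together. *)
Definition sigma_of (I : finType) (X : I -> {RV P >-> R}) : set (set T) :=
  <<s \bigcup_i preimage_set_system setT (X i) measurable >>.

Definition independent_families (I J : finType)
    (X : I -> {RV P >-> R}) (Y : J -> {RV P >-> R}) : Prop :=
  forall A B, sigma_of X A -> sigma_of Y B -> P (A `&` B) = (P A * P B)%E.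

End random_families.

(* Main.v *)
Require Import Defs.
From mathcomp Require Import all_boot all_order all_algebra.
From mathcomp Require Import all_classical all_reals all_analysis.
From mathcomp Require Import measurable_realfun ring lra.

(** Write f for the mean size of the matching, a function of the weights, and S
    for the sum of the n edge weights.  Projecting f on the first Gaussian
    chaos in the single direction S is enough.

    Expanding 0 <= E (f - E f - l S)^2 gives, for every real l,
    Var f >= 2 l E[S (f - E f)] - l^2 E[S^2], and E[S^2] is n times the second
    moment of the standard normal law ([variance_lower_bound],
    [gaussian_sum_sqr]).  The derivative of f in the weight of an edge a is the
    Gibbs covariance of |M| with the indicator of a ([is_derive_gibbs]), so
    Gaussian integration by parts ([gaussian_integration_by_parts]) turns
    E[w_a (f - E f)] into the mean of that covariance.  Summed over a, the
    indicators add up to |M|, and E[S (f - E f)] is the mean of the Gibbs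
    variance of |M|.  With l a small constant, it remains to bound that mean
    from below by a multiple of n.

    For fixed weights, the Gibbs variance of |M| is compared with the variance
    of a sum h of local fluctuations: the fluctuation of a is centred given the
    other edges of the matching, so the fluctuations of two disjoint edges are
    orthogonal, while the covariance of h with |M| is a sum of local terms
    ([gibbs_variance_lower_bound]).  The term of a is bounded below by a
    constant depending on D and K as soon as the weights around a are at most
    K in absolute value: a matching can be changed near a so as to contain a,
    at a bounded cost and with boundedly many preimages ([probability_of_ge]).
    Taking K large makes the weights around a given edge bounded by K with
    probability at least one half, whatever the graph. *)

Set Implicit Arguments.
Unset Strict Implicit.
Unset Printing Implicit Defensive.

Import Order.TTheory GRing.Theory Num.Theory.
Import numFieldNormedType.Exports.
Local Open Scope classical_set_scope.
Local Open Scope ring_scope.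

(** * Touching edges and insertions into a matching *)

Section touching.
Variable G : sgraph.
Implicit Types (a b : edge G) (M : {set edge G}).

(** Closed neighbourhoods in the line graph: an edge touches itself. *)
Definition touching a b := ~~ [disjoint val a & val b].

Definition insertable a M := (a \notin M) && (a |: M \in matchings G)%SET.

Lemma touching_sym a b : touching a b = touching b a.
Proof. by rewrite /touching disjoint_sym. Qed.

Lemma edgeP a : exists x y, adj x y /\ val a = [set x; y]%SET.
Proof.
by case: a => A /=; move=> /imsetP[[x y]]; rewrite inE /= => xy ->; exists x, y.
Qed.

Lemma touching_refl a : touching a a.
Proof.
rewrite /touching; have [x [y [_ ->]]] := edgeP a.
by apply/negP => /disjoint_setI0; rewrite finset.setIid => /setP/(_ x); rewrite !inE eqxx.
Qed.

Lemma matchingP M :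
  reflect {in M &, forall a b, touching a b -> a = b} (M \in matchings G).
Proof.
rewrite inE; apply: (iffP forall_inP) => [h a b aM bM|h a aM].
  move=> /negP t; apply/eqP/contraT => ab; case: t.
  by move/forall_inP: (h a aM) => /(_ b bM); rewrite ab.
apply/forall_inP => b bM; apply/implyP => ab; apply/contraT => t.
by move: ab; rewrite (h a b aM bM t) eqxx.
Qed.

Lemma matchingS M M' : (M' \subset M)%SET -> M \in matchings G -> M' \in matchings G.
Proof.
move=> /fintype.subsetP s /matchingP h; apply/matchingP => a b aM bM.
by apply: h; apply: s.
Qed.

Lemma set0_matching : finset.set0 \in matchings G.
Proof. by apply/matchingP => a b; rewrite inE. Qed.

Lemma matchingU1 a M :
  (a |: M \in matchings G)%SET =
  (M \in matchings G) && [forall b in M, touching a b ==> (a == b)].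
Proof.
apply/idP/andP => [h|[/matchingP hM /forall_inP ha]].
  split; first by apply: matchingS h; apply: finset.subsetUr.
  apply/forall_inP => b bM; apply/implyP => ab; apply/eqP.
  by move/matchingP : h; apply; rewrite ?inE ?eqxx ?bM ?orbT.
apply/matchingP => b c; rewrite !inE => /orP[/eqP->|bM] /orP[/eqP->|cM] //.
- by move=> t; move: (ha _ cM) => /implyP/(_ t)/eqP.
- by rewrite touching_sym => t; move: (ha _ bM) => /implyP/(_ t)/eqP.
- exact: hM.
Qed.

(** An edge is determined by one of its ends and the neighbour at the other, so
    each end of [a] lies on at most [D] edges. *)
Lemma card_touching D (a : edge G) : (forall x : G, (degree x <= D)%N) ->
  (#|[set b | touching a b]%SET| <= D.*2)%N.
Proof.
move=> hD; have [x [y [_ ea]]] := edgeP a.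
have star z : (#|[set b : edge G | z \in val b]%SET| <= D)%N.
  apply: leq_trans (hD z); rewrite /degree.
  rewrite -(card_imset _ val_inj).
  apply: leq_trans (leq_imset_card (fun u : G => [set z; u]%SET) _).
  apply/subset_leq_card/fintype.subsetP => A /imsetP[b]; rewrite inE => zb ->.
  have [u [v [uv eb]]] := edgeP b.
  move: zb; rewrite eb !inE => /orP[] /eqP zE.
    by apply/imsetP; exists v; rewrite ?inE zE.
  by apply/imsetP; exists u; rewrite ?inE zE ?(adj_sym v u)// finset.setUC.
rewrite -addnn; apply: leq_trans (leq_add (star x) (star y)).
apply: leq_trans (leq_card_setU _ _); apply/subset_leq_card/fintype.subsetP => b.
rewrite !inE => /pred0Pn[z]/= /andP[]; rewrite ea !inE.
by move=> /orP[]/eqP-> ->; rewrite ?orbT.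
Qed.

End touching.

(** * Fluctuations of the Gibbs measure for fixed weights *)

Section gibbs_theory.
Variables (R : realType) (G : sgraph) (w : edge G -> R) (nu : G -> R).
Implicit Types (a b : edge G) (M : {set edge G}) (f g : {set edge G} -> R).

Local Notation "''G[' f ]" := (gibbs_expectation w nu f)
  (at level 0, f at level 200, format "''G[' f ]").
Local Notation Z := (partition_function w nu).

Lemma partition_function_gt0 : 0 < Z.
Proof.
rewrite /partition_function (bigD1 finset.set0) ?set0_matching //=.
by rewrite ltr_wpDr ?expR_gt0// sumr_ge0// => M _; rewrite expR_ge0.
Qed.

Lemma gibbs_expectationE f :
  'G[f] = (\sum_(M in matchings G) boltzmann w nu M * f M) / Z.
Proof.
rewrite /gibbs_expectation big_distrl/=; apply: eq_bigr => M _.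
by rewrite /gibbs mulrAC.
Qed.

Lemma eq_gibbs f g : {in matchings G, f =1 g} -> 'G[f] = 'G[g].
Proof. by move=> fg; apply: eq_bigr => M /fg ->. Qed.

Lemma gibbsD f g : 'G[fun M => f M + g M] = 'G[f] + 'G[g].
Proof. by rewrite -big_split/=; apply: eq_bigr => M _; rewrite mulrDr. Qed.

Lemma gibbsZ c f : 'G[fun M => c * f M] = c * 'G[f].
Proof.
by rewrite /gibbs_expectation big_distrr/=; apply: eq_bigr => M _; rewrite mulrCA.
Qed.

Lemma gibbsB f g : 'G[fun M => f M - g M] = 'G[f] - 'G[g].
Proof.
rewrite gibbsD; congr (_ + _).
by rewrite -mulN1r -gibbsZ; apply: eq_gibbs => M _; rewrite mulN1r.
Qed.

Lemma gibbs_sum (I : finType) (P : pred I) (F : I -> {set edge G} -> R) :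
  'G[fun M => \sum_(i | P i) F i M] = \sum_(i | P i) 'G[F i].
Proof.
rewrite /gibbs_expectation exchange_big/=; apply: eq_bigr => M _.
by rewrite big_distrr.
Qed.

Lemma gibbs_cst c : 'G[fun=> c] = c.
Proof.
by rewrite gibbs_expectationE -big_distrl/= mulrAC divff ?mul1r// gt_eqF ?partition_function_gt0.
Qed.

Lemma gibbs_le f g : {in matchings G, forall M, f M <= g M} -> 'G[f] <= 'G[g].
Proof.
move=> fg; apply: ler_sum => M MM; apply: ler_wpM2l; last exact: fg.
by rewrite divr_ge0 ?expR_ge0 ?(ltW partition_function_gt0).
Qed.

Lemma gibbs_ge0 f : {in matchings G, forall M, 0 <= f M} -> 0 <= 'G[f].
Proof. by move=> f0; rewrite -(gibbs_cst 0); apply: gibbs_le. Qed.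

(** The logarithm of the factor gained by matching two free vertices along [a]. *)
Definition log_activity a := w a - \sum_(x in val a) nu x.
Definition activity a := expR (log_activity a).

(** Charging to each edge of [M] the weights of the two vertices that it covers
    makes the Gibbs weight multiplicative over the edges. *)
Lemma boltzmann_activity M : M \in matchings G ->
  boltzmann w nu M = boltzmann w nu finset.set0 * \prod_(a in M) activity a.
Proof.
move=> /matchingP hM; rewrite /boltzmann -expR_sum -expRD; congr expR.
rewrite big_set0 add0r sumrB.
have -> : \sum_(x in unmatched (finset.set0 : {set edge G})) nu x = \sum_x nu x.
  by apply: eq_bigl => x; rewrite inE; apply/forall_inP => a; rewrite inE.
rewrite [in RHS](bigID (fun x => x \in unmatched M))/=.
have -> : \sum_(x | x \notin unmatched M) nu x = \sum_(a in M) \sum_(x in val a) nu x.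
  pose F a := if a \in M then val a else finset.set0.
  have FE a : \sum_(x in F a) nu x = if a \in M then \sum_(x in val a) nu x else 0.
    by rewrite /F; case: ifP => // _; rewrite big_set0.
  rewrite [RHS]big_mkcond/=; under [RHS]eq_bigr do rewrite -FE.
  rewrite -partition_disjoint_bigcup/=; last first.
    move=> a b ab; rewrite /F; case: ifP => aM; last by rewrite -setI_eq0 finset.set0I.
    case: ifP => bM; last by rewrite -setI_eq0 finset.setI0.
    by apply/contraT => t; rewrite (hM a b) ?eqxx in ab.
  apply: eq_bigl => x; rewrite inE negb_forall_in; apply/exists_inP/bigcupP.
    by move=> [a aM]; rewrite negbK => xa; exists a; rewrite // /F aM.
  by move=> [a _]; rewrite /F; case: ifP => [aM xa|]; [exists a; rewrite ?negbK|rewrite inE].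
lra.
Qed.

Lemma boltzmannU1 a M : insertable a M ->
  boltzmann w nu (a |: M)%SET = activity a * boltzmann w nu M.
Proof.
move=> /andP[aM haM]; rewrite boltzmann_activity// (@boltzmann_activity M); last first.
  by apply: matchingS haM; apply: finset.subsetUr.
by rewrite big_setU1//= mulrCA.
Qed.

Definition probability_of a := 'G[fun M => (a \in M)%:R].

(** Given the rest of the matching, and when [a] can be present, [a] is present
    with odds [activity a] to 1: the coefficient makes the conditional mean
    vanish. *)
Definition fluctuation a M : R :=
  (a \in M)%:R - activity a * (insertable a M)%:R.

(** Detailed balance: inserting [a] is a bijection from the matchings in which
    [a] is insertable onto those containing [a], and it multiplies the weight by
    [activity a]. *)
Lemma gibbs_insertion a f :
  'G[fun M => (a \in M)%:R * f M] =
  activity a * 'G[fun M => (insertable a M)%:R * f (a |: M)%SET].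
Proof.
rewrite !gibbs_expectationE mulrA; congr (_ / _).
transitivity (\sum_(M in matchings G | a \in M) boltzmann w nu M * f M).
  rewrite [RHS]big_mkcondr/=; apply: eq_bigr => M _.
  by case: (a \in M); rewrite ?mul1r ?mul0r ?mulr0.
transitivity (\sum_(M | insertable a M) boltzmann w nu (a |: M)%SET * f (a |: M)%SET).
  rewrite (reindex_onto (fun M => a |: M)%SET (fun M => M :\ a)%SET)/=; last first.
    by move=> M /andP[_ aM]; rewrite finset.setD1K.
  apply: eq_bigl => M; rewrite /insertable !inE eqxx/= andbT -/(a |: M)%SET.
  rewrite andbC; congr (_ && _); apply/eqP/idP => [<-|aM]; first by rewrite !inE eqxx.
  by rewrite setU1K.
rewrite big_distrr/= [RHS]big_mkcond [LHS]big_mkcond/=; apply: eq_bigr => M _.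
case: ifPn => [i|_].
  rewrite boltzmannU1//.
  rewrite ifT; last by move: i => /andP[_]; apply: matchingS; apply: finset.subsetUr.
  by rewrite mul1r !mulrA.
by case: ifP => // _; rewrite mul0r !mulr0.
Qed.

(** The two halves of the fluctuation cancel except for the change of [f] when
    [a] is inserted; the following lemmas are instances. *)
Lemma gibbs_fluctuation a f :
  'G[fun M => fluctuation a M * f M] =
  activity a * 'G[fun M => (insertable a M)%:R * (f (a |: M)%SET - f M)].
Proof.
under eq_gibbs do rewrite /fluctuation mulrBl -mulrA.
rewrite gibbsB gibbsZ gibbs_insertion -mulrBr -gibbsB.
by congr (_ * _); apply: eq_gibbs => M _; rewrite mulrBr.
Qed.

Lemma probability_ofE a :
  probability_of a = activity a * 'G[fun M => (insertable a M)%:R].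
Proof.
rewrite /probability_of; under eq_gibbs do rewrite -[_%:R]mulr1.
rewrite (gibbs_insertion a (fun=> 1)); congr (_ * _).
by apply: eq_gibbs => M _; rewrite mulr1.
Qed.

Lemma gibbs_fluctuation0 a : 'G[fluctuation a] = 0.
Proof.
under eq_gibbs do rewrite -[fluctuation _ _]mulr1.
rewrite (gibbs_fluctuation a (fun=> 1)).
under eq_gibbs do rewrite subrr mulr0.
by rewrite gibbs_cst mulr0.
Qed.

Lemma gibbs_fluctuation_card a :
  'G[fun M => fluctuation a M * #|M|%:R] = probability_of a.
Proof.
rewrite (gibbs_fluctuation a (fun M => #|M|%:R)) probability_ofE; congr (_ * _).
apply: eq_gibbs => M _; have [/andP[aM _]|] := boolP (insertable a M).
  by rewrite cardsU1 aM natrD addrK mulr1.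
by rewrite mul0r.
Qed.

Lemma gibbs_fluctuation_sqr a :
  'G[fun M => fluctuation a M * fluctuation a M] =
  (1 + activity a) * probability_of a.
Proof.
rewrite gibbs_fluctuation probability_ofE mulrCA; congr (_ * _); rewrite -gibbsZ.
apply: eq_gibbs => M _; have [i|] := boolP (insertable a M); last first.
  by rewrite mul0r mulr0.
rewrite /fluctuation !inE eqxx i; have /andP[/negbTE-> _] := i.
rewrite /insertable !inE eqxx/=; ring.
Qed.

(** Inserting [a] affects neither the presence nor the insertability of an edge
    disjoint from [a]. *)
Lemma gibbs_fluctuation_far a b : ~~ touching a b ->
  'G[fun M => fluctuation a M * fluctuation b M] = 0.
Proof.
move=> nab; rewrite gibbs_fluctuation.
have ab : a != b by apply: contraNneq nab => ->; exact: touching_refl.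
rewrite -[RHS](mulr0 (activity a)) -(gibbs_cst 0); congr (_ * _).
apply: eq_gibbs => M _; have [/andP[aM iaM]|] := boolP (insertable a M); last first.
  by rewrite mul0r.
rewrite mul1r /fluctuation /insertable in_setU1 eq_sym (negbTE ab)/=.
suff -> : (b |: (a |: M) \in matchings G)%SET = (b |: M \in matchings G)%SET.
  by rewrite subrr.
rewrite [LHS]matchingU1 [RHS]matchingU1 iaM/=.
have -> : M \in matchings G by apply: matchingS iaM; apply: finset.subsetUr.
apply/forall_inP/forall_inP => h c cM; first by apply: h; rewrite !inE cM orbT.
move: cM; rewrite !inE => /orP[/eqP->|]; last exact: h.
by rewrite touching_sym (negbTE nab).
Qed.

Definition gibbs_covariance f g := 'G[fun M => f M * g M] - 'G[f] * 'G[g].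

(** The size of the matching is tested against
    [h = \sum_a (1 + activity a)^-1 * fluctuation a].  The covariance of [h]
    with the size is the sum [V] on the left.  Only touching edges contribute to
    the second moment of [h], and there are at most [2D] of them around each
    edge, so that this moment is at most [2D V]. *)
Lemma gibbs_variance_lower_bound D : (forall x : G, (degree x <= D)%N) ->
  (\sum_a (1 + activity a)^-1 * probability_of a) / (D.*2.+1)%:R <=
  gibbs_covariance (fun M => #|M|%:R) (fun M => #|M|%:R).
Proof.
move=> hD; set V := \sum_a _; set X : {set edge G} -> R := fun M => #|M|%:R.
pose s a := (1 + activity a)^-1.
have r0 a : 0 < 1 + activity a by rewrite addr_gt0// expR_gt0.
have s0 a : 0 < s a by rewrite invr_gt0.
pose h M := \sum_a s a * fluctuation a M.
have p0 a : 0 <= probability_of a by apply: gibbs_ge0 => M _; exact: ler0n.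
have V0 : 0 <= V.
  by apply: sumr_ge0 => a _; apply: mulr_ge0 => //; exact: (ltW (s0 a)).
have h0 : 'G[h] = 0.
  rewrite /h gibbs_sum big1// => a _.
  by rewrite gibbsZ gibbs_fluctuation0 mulr0.
have Xh : 'G[fun M => h M * X M] = V.
  under eq_gibbs do rewrite /h big_distrl/=.
  rewrite gibbs_sum; apply: eq_bigr => a _.
  under eq_gibbs do rewrite -mulrA.
  by rewrite gibbsZ gibbs_fluctuation_card.
pose q a := s a * probability_of a.
have qE a : 'G[fun M => (s a * fluctuation a M) * (s a * fluctuation a M)] = q a.
  under eq_gibbs do rewrite mulrACA.
  rewrite gibbsZ gibbs_fluctuation_sqr /q /s; field; exact: lt0r_neq0.
have qab a b : 'G[fun M => (s a * fluctuation a M) * (s b * fluctuation b M)]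
    <= (touching a b)%:R * (2^-1 * (q a + q b)).
  have [t|nt] := boolP (touching a b); last first.
    under eq_gibbs do rewrite mulrACA.
    by rewrite gibbsZ gibbs_fluctuation_far// mulr0 mul0r.
  rewrite mul1r -!qE -gibbsD -gibbsZ; apply: gibbs_le => M _.
  set u := s a * _; set v := s b * _.
  have := sqr_ge0 (u - v); rewrite expr2; nra.
have hh : 'G[fun M => h M * h M] <= (D.*2)%:R * V.
  under eq_gibbs do rewrite /h big_distrlr/=.
  rewrite gibbs_sum; under eq_bigr do rewrite gibbs_sum.
  apply: (@le_trans _ _ (\sum_a \sum_b (touching a b)%:R * (2^-1 * (q a + q b)))).
    by apply: ler_sum => a _; apply: ler_sum => b _; exact: qab.
  have -> : \sum_a \sum_b (touching a b)%:R * (2^-1 * (q a + q b)) =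
      \sum_a q a * \sum_b (touching a b)%:R.
    have E1 : \sum_a \sum_b (touching a b)%:R * q b =
        \sum_a q a * \sum_b (touching a b)%:R.
      rewrite exchange_big/=; apply: eq_bigr => a _; rewrite big_distrr/=.
      by apply: eq_bigr => b _; rewrite mulrC touching_sym.
    have E2 : \sum_a \sum_b (touching a b)%:R * q a =
        \sum_a q a * \sum_b (touching a b)%:R.
      by apply: eq_bigr => a _; rewrite big_distrr/=; apply: eq_bigr => b _; rewrite mulrC.
    transitivity (2^-1 * (\sum_a \sum_b (touching a b)%:R * q a +
        \sum_a \sum_b (touching a b)%:R * q b)); last by rewrite E1 E2; field.
    rewrite -big_split big_distrr/=; apply: eq_bigr => a _.
    rewrite -big_split big_distrr/=; apply: eq_bigr => b _; ring.
  rewrite /V big_distrr/=; apply: ler_sum => a _; rewrite [leRHS]mulrC.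
  apply: ler_wpM2l; first by rewrite mulr_ge0// ltW.
  rewrite -natr_sum ler_nat -big_mkcond/= sum1_card -cardsE.
  exact: card_touching.
(* With this l, 2 * l - (2 * D) * l ^ 2 = l + l ^ 2 >= l. *)
set l : R := (D.*2.+1)%:R^-1.
have Dl : (D.*2)%:R * l = 1 - l.
  have := ltr0Sn R D.*2; rewrite -(natr1 D.*2) /l -(natr1 D.*2) => h1.
  field; exact: lt0r_neq0.
have l0 : 0 < l by rewrite invr_gt0 ltr0Sn.
have := @gibbs_ge0 (fun M => (X M - 'G[X] - l * h M) ^+ 2)
  (fun M _ => sqr_ge0 _).
set m := 'G[X].
have -> : 'G[fun M => (X M - m - l * h M) ^+ 2] =
  'G[fun M => (X M * X M)] - m * m + l * l * 'G[fun M => h M * h M] - 2 * l * V.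
  transitivity ('G[fun M => (((X M * X M + (- 2 * m) * X M) + m * m) +
      ((l * l) * (h M * h M))) + ((- 2 * l) * (h M * X M) + (2 * l * m) * h M)]).
    by apply: eq_gibbs => M _; ring.
  rewrite !(gibbsD, gibbsZ) gibbs_cst Xh h0 -/m; ring.
rewrite /gibbs_covariance -/m; move: hh; set H := 'G[_]; set X2 := 'G[_].
move=> hh hX.
have : l * l * H <= (1 - l) * l * V.
  rewrite -Dl.
  have -> : D.*2%:R * l * l * V = l * l * (D.*2%:R * V) by ring.
  by apply: ler_wpM2l => //; rewrite mulr_ge0// ltW.
nra.
Qed.

(** Replace the edges of a matching [M] that touch [a] by [a] itself.  This
    changes the weight by at most [2D + 1] activities, and [M] is recovered from
    its image together with its trace on the at most [2D] edges touching [a]. *)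
Lemma probability_of_ge D (L : R) a : (forall x : G, (degree x <= D)%N) ->
  (forall b, touching a b -> `|log_activity b| <= L) ->
  ((2 ^+ D.*2)^-1 * expR (- (L * D.*2.+1%:R))) <= probability_of a.
Proof.
move=> hD hL; have L0 : 0 <= L.
  by apply: le_trans (hL a (touching_refl a)).
pose N := [set b | touching a b]%SET.
have aN : a \in N by rewrite inE touching_refl.
have ub b : b \in N -> activity b <= expR L.
  by rewrite inE => /hL; rewrite ler_norml ler_expR => /andP[].
have lb : (activity a)^-1 <= expR L.
  rewrite -expRN ler_expR; have := hL a (touching_refl a).
  rewrite ler_norml; lra.
pose C : R := expR (L * D.*2.+1%:R).
pose M' (M : {set edge G}) := (a |: (M :\: N))%SET.
have ins M : M \in matchings G -> insertable a (M :\: N)%SET.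
  move=> MM; rewrite /insertable finset.in_setD aN/= matchingU1.
  rewrite (matchingS (finset.subsetDl _ _))//=.
  by apply/forall_inP => b; rewrite !inE => /andP[/negbTE->].
have step M : M \in matchings G -> boltzmann w nu M <= C * boltzmann w nu (M' M).
  move=> MM; have aM := ins M MM.
  rewrite (boltzmannU1 aM) (boltzmann_activity MM) (big_setID N)/=.
  rewrite (@boltzmann_activity (M :\: N)%SET) ?(matchingS (finset.subsetDl _ _))//.
  set B0 := boltzmann _ _ _; set Q := \prod_(i in M :\: N) _; set S := \prod_(_ in _) _.
  have Q0 : 0 <= Q by apply: prodr_ge0 => b _; exact: expR_ge0.
  have S1 : S <= expR (L * D.*2%:R).
    apply: (@le_trans _ _ (\prod_(i in M :&: N) expR L)).
      apply: ler_prod => b; rewrite inE => /andP[_ bN].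
      by rewrite expR_ge0 ub.
    rewrite prodr_const -expRM_natr ler_expR; apply: ler_wpM2l => //.
    rewrite ler_nat; apply: leq_trans (card_touching a hD).
    exact/subset_leq_card/finset.subsetIr.
  have Ca : expR (L * D.*2%:R) <= C * activity a.
    rewrite /C -natr1 mulrDr mulr1 expRD -mulrA.
    rewrite ler_peMr ?expR_ge0// -ler_pdivrMr ?expR_gt0// mul1r; exact: lb.
  rewrite [leLHS](_ : _ = S * (B0 * Q)); last by ring.
  rewrite [leRHS](_ : _ = C * activity a * (B0 * Q)); last by ring.
  apply: ler_wpM2r; first by rewrite mulr_ge0// expR_ge0.
  exact: le_trans Ca.
have Zle : Z <= 2 ^+ D.*2 * (C * \sum_(M in matchings G) boltzmann w nu M * (a \in M)%:R).
  rewrite /partition_function.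
  rewrite (partition_big (fun M => M :&: N)%SET (fun S => S \in powerset N))/=; last first.
    by move=> M _; rewrite inE finset.subsetIr.
  set W := \sum_(M in matchings G) _.
  have W0 : 0 <= W by apply: sumr_ge0 => M _; rewrite mulr_ge0// expR_ge0.
  apply: (@le_trans _ _ (\sum_(S in powerset N) C * W)); last first.
    rewrite sumr_const card_powerset -[leLHS]mulr_natl natrX.
    apply: ler_wpM2r; first by rewrite mulr_ge0// expR_ge0.
    by apply: ler_weXn2l; [rewrite ler1n|exact: card_touching].
  apply: ler_sum => S _.
  apply: (@le_trans _ _ (\sum_(M in matchings G | (M :&: N)%SET == S)
     C * boltzmann w nu (M' M))).
    by apply: ler_sum => M /andP[MM _]; exact: step.
  rewrite -big_distrr/=; apply: ler_wpM2l; first exact: expR_ge0.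
  (* For a fixed trace S on N, M is the union of S and of M' M minus a. *)
  have inj : {in [pred M | (M \in matchings G) && ((M :&: N)%SET == S)] &, injective M'}.
    move=> M1 M2 /andP[m1 /eqP e1] /andP[m2 /eqP e2] e.
    rewrite -(finset.setID M1 N) -(finset.setID M2 N) e1 e2; congr (_ :|: _)%SET.
    have /andP[n1 _] := ins _ m1; have /andP[n2 _] := ins _ m2.
    by rewrite -(setU1K n1) -/(M' M1) e setU1K.
  rewrite -(@big_imset _ _ _ _ _ M' _ (boltzmann w nu) inj)/=.
  rewrite /W [leRHS]big_mkcond [leLHS]big_mkcond/=; apply: ler_sum => M _.
  case: ifPn => [/imsetP[M1 /andP[m1 _] ->]|_]; last first.
    by case: ifP => // _; rewrite mulr_ge0// expR_ge0.
  have /andP[_ ->] := ins _ m1.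
  by rewrite !inE eqxx mulr1.
rewrite /probability_of gibbs_expectationE ler_pdivlMr ?partition_function_gt0//.
rewrite expRN -/C -invfM mulrC ler_pdivrMr.
  by rewrite mulrC -mulrA.
by rewrite mulr_gt0// ?exprn_gt0// expR_gt0.
Qed.

End gibbs_theory.

Section gibbs_bounds.
Variables (R : realType) (G : sgraph) (w : edge G -> R) (nu : G -> R).

Lemma gibbs_norm_le (C : R) f : (forall M, `|f M| <= C) ->
  `|gibbs_expectation w nu f| <= C.
Proof.
move=> fC; rewrite ler_norml -{2}(gibbs_cst w nu C) -(gibbs_cst w nu (- C)).
by apply/andP; split; apply: gibbs_le => M _; have := fC M; rewrite ler_norml => /andP[].
Qed.

Lemma gibbs_covariance_norm_le (C : R) a f : (forall M, `|f M| <= C) ->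
  `|gibbs_covariance w nu (fun M => (a \in M)%:R) f| <= 2 * C.
Proof.
move=> fC; have h1 : forall M : {set edge G}, `|((a \in M)%:R : R)| <= 1.
  by move=> M; case: (a \in M); rewrite ?normr1 ?normr0.
rewrite mulr_natl mulr2n; apply: le_trans (ler_normB _ _) _; apply: lerD.
  apply: gibbs_norm_le => M; rewrite normrM -[leRHS]mul1r.
  by apply: ler_pM.
rewrite normrM -[leRHS]mul1r; apply: ler_pM => //; exact: gibbs_norm_le.
Qed.

(** The value of the bound of [gibbs_variance_lower_bound], per edge, when all
    the weights around that edge are at most [K]; activities then lie between
    [expR (- (3 * K))] and [expR (3 * K)], as three weights enter in each. *)
Definition variance_constant (D : nat) (K : R) : R :=
  (1 + expR (3 * K))^-1 *
  ((2 ^+ D.*2)^-1 * expR (- (3 * K * D.*2.+1%:R))) / D.*2.+1%:R.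

(** The subtracted count makes the term of [a] nonpositive, hence the bound
    trivial, as soon as some weight around [a] exceeds [K].  The bound is linear
    in the tail indicators, so that only their means enter later. *)
Lemma gibbs_variance_truncated D (K : R) : 0 <= K ->
  (forall x : G, (degree x <= D)%N) ->
  variance_constant D K * (\sum_a (1 - \sum_(b | touching a b)
    ((K < `|w b|)%R%:R + \sum_(x in val b) (K < `|nu x|)%R%:R))) <=
  gibbs_covariance w nu (fun M => #|M|%:R) (fun M => #|M|%:R).
Proof.
move=> K0 hD; apply: le_trans (gibbs_variance_lower_bound w nu hD).
rewrite /variance_constant mulrAC; apply: ler_wpM2r; first by rewrite invr_ge0.
rewrite big_distrr/=; apply: ler_sum => a _.
set c := _^-1 * _; set s := \sum_(b | _) _.
have c0 : 0 <= c.
  by rewrite mulr_ge0 ?invr_ge0 ?addr_ge0 ?mulr_ge0 ?invr_ge0 ?exprn_ge0 ?expR_ge0.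
have p0 : 0 <= probability_of w nu a by apply: gibbs_ge0 => M _; exact: ler0n.
have t0 b : 0 <= ((K < `|w b|)%R%:R + \sum_(x in val b) (K < `|nu x|)%R%:R : R).
  by rewrite addr_ge0// sumr_ge0.
have [/forall_inP good|bad] := boolP [forall (b | touching a b),
    (`|w b| <= K) && [forall x in val b, `|nu x| <= K]].
  have hL b : touching a b -> `|log_activity w nu b| <= 3 * K.
    move=> /good/andP[wb /forall_inP nb].
    apply: le_trans (ler_normB _ _) _.
    have : `|\sum_(x in val b) nu x| <= 2 * K.
      apply: le_trans (ler_norm_sum _ _ _) _.
      apply: le_trans (ler_sum _ (fun x xb => nb x xb)) _.
      rewrite sumr_const -[leLHS]mulr_natl ler_wpM2r//.
      have [x [y [_ ->]]] := edgeP b.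
      by rewrite cards2 ler_nat; case: (_ != _).
    lra.
  have s1 : 0 <= s by apply: sumr_ge0 => b _.
  apply: (@le_trans _ _ c); first by rewrite ler_piMr// lerBlDr lerDl.
  apply: ler_pM; rewrite ?invr_ge0 ?addr_ge0 ?mulr_ge0 ?invr_ge0 ?exprn_ge0 ?expR_ge0//.
    rewrite lef_pV2 ?posrE ?addr_gt0 ?expR_gt0// lerD2l ler_expR.
    by have := hL a (touching_refl a); rewrite ler_norml => /andP[].
  exact: probability_of_ge.
apply: (@le_trans _ _ 0); last by rewrite mulr_ge0// invr_ge0 addr_ge0// expR_ge0.
rewrite mulr_ge0_le0// subr_le0.
move: bad; rewrite negb_forall_in => /exists_inP[b ab].
rewrite /s (bigD1 b)//= negb_and -ltNge => h.
rewrite -[leLHS]addr0; apply: lerD; last by apply: sumr_ge0 => b' _; exact: t0.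
case/orP : h => [->/=|]; first by rewrite mulr1n lerDl sumr_ge0.
rewrite negb_forall_in => /exists_inP[x xb]; rewrite -ltNge => hx.
rewrite (bigD1 x)//= hx/= mulr1n addrCA lerDl addr_ge0// sumr_ge0//.
Qed.

End gibbs_bounds.

(** * The Gibbs measure as a function of one edge weight *)

Section gibbs_derivative.
Variables (R : realType) (G : sgraph) (w : edge G -> R) (nu : G -> R) (a : edge G).
Implicit Types (M : {set edge G}) (f g : {set edge G} -> R) (t : R).

Definition set_weight t b := if b == a then t else w b.

Let numerator f t := \sum_(M in matchings G) boltzmann (set_weight t) nu M * f M.

Lemma is_derive_boltzmann M t :
  is_derive t (1 : R) (fun t => boltzmann (set_weight t) nu M)
    ((a \in M)%:R * boltzmann (set_weight t) nu M).
Proof.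
pose c := boltzmann (set_weight 0) nu M.
have E : (fun t => boltzmann (set_weight t) nu M) =
   (fun t => c * expR ((a \in M)%:R * t)).
  apply/funext => u; rewrite /c /boltzmann -expRD; congr expR.
  have [aM|aM] := boolP (a \in M); last first.
    rewrite mul0r addr0; congr (_ + _); apply: eq_bigr => b bM.
    by rewrite /set_weight; case: eqP => // ba; rewrite -ba bM in aM.
  rewrite (bigD1 a)//= [in RHS](bigD1 a)//= {1 3}/set_weight eqxx add0r mul1r.
  rewrite [RHS]addrC addrA; congr (_ + _ + _).
  by apply: eq_bigr => b /andP[_ /negbTE ba]; rewrite /set_weight ba.
have := E; move/(congr1 (fun h => h t)) => /= Et.
rewrite Et E; apply: is_derive_eq.
rewrite /GRing.scale/=; ring.
Qed.

Let is_derive_numerator f t :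
  is_derive t (1 : R) (numerator f) (numerator (fun M => (a \in M)%:R * f M) t).
Proof.
have -> : numerator f =
    \sum_(M in matchings G) (fun t => boltzmann (set_weight t) nu M * f M).
  by apply/funext => u; rewrite fct_sumE.
rewrite /numerator; elim/big_ind2 : _ => [|f1 d1 f2 d2 h1 h2|M _].
- exact: is_derive_cst.
- exact: is_deriveD.
- have h := is_derive_boltzmann M t.
  have -> : (fun t => boltzmann (set_weight t) nu M * f M) =
     (f M \*: (fun t => boltzmann (set_weight t) nu M)).
    by apply/funext => u; rewrite /= mulrC.
  apply: is_derive_eq; rewrite /GRing.scale/=; ring.
Qed.

(** Differentiating a Gibbs weight in the weight of [a] multiplies it by the
    indicator of [a]; the quotient rule then produces a covariance. *)
Lemma is_derive_gibbs f t :
  is_derive t (1 : R) (fun t => gibbs_expectation (set_weight t) nu f)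
    (gibbs_covariance (set_weight t) nu (fun M => (a \in M)%:R) f).
Proof.
have N0 u : numerator (fun=> 1) u != 0.
  rewrite gt_eqF// /numerator; under eq_bigr do rewrite mulr1.
  exact: partition_function_gt0.
have GE g u : gibbs_expectation (set_weight u) nu g =
    numerator g u * (numerator (fun=> 1) u)^-1.
  rewrite gibbs_expectationE /partition_function /numerator.
  by congr (_ / _); apply: eq_bigr => M _; rewrite mulr1.
have -> : (fun u => gibbs_expectation (set_weight u) nu f) =
    numerator f * (fun u => (numerator (fun=> 1) u)^-1).
  by apply/funext => u; rewrite GE.
have h1 := is_derive_numerator f t.
have h2 := is_deriveV (N0 t) (is_derive_numerator (fun=> 1) t).
apply: is_derive_eq; rewrite /gibbs_covariance !GE /GRing.scale/=.
have -> : numerator (fun M => (a \in M)%:R * 1) t = numerator (fun M => (a \in M)%:R) t.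
  by apply: eq_bigr => M _; rewrite mulr1.
field; exact: N0.
Qed.

Lemma continuous_gibbs f :
  continuous (fun t => gibbs_expectation (set_weight t) nu f).
Proof.
move=> t; apply/differentiable_continuous/derivable1_diffP.
by have [] := is_derive_gibbs f t.
Qed.

Lemma continuous_gibbs_covariance f g :
  continuous (fun t => gibbs_covariance (set_weight t) nu f g).
Proof.
move=> t; apply: cvgB; first exact: continuous_gibbs.
by apply: cvgM; exact: continuous_gibbs.
Qed.

End gibbs_derivative.

(** * Stein's identity for the standard normal law *)

Section normal_integral.
Variable R : realType.
Local Notation mu := (@lebesgue_measure R).
Local Notation gamma := (@normal_prob R 0 1).
Local Notation phi := (@normal_pdf R 0 1).

(** The normal density is a version of the Radon-Nikodym derivative. *)
Lemma ge0_integral_normal_prob (m s : R) (f : R -> \bar R) :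
  measurable_fun setT f -> (forall x, 0 <= f x)%E ->
  (\int[normal_prob m s]_x f x = \int[mu]_x (f x * (normal_pdf m s x)%:E))%E.
Proof.
move=> mf f0.
have dom := normal_prob_dominates m s.
rewrite -(Radon_Nikodym_SigmaFinite.change_of_variables dom)//.
have ih := Radon_Nikodym_SigmaFinite.f_integrable dom.
apply: ae_eq_integral => //.
- by apply: emeasurable_funM => //; exact: (measurable_int _ ih).
- apply: emeasurable_funM => //; apply/measurable_EFinP.
  exact: measurable_normal_pdf.
- apply: ae_eqe_mul2l; apply: integral_ae_eq => //.
  + by apply/measurable_EFinP; exact: measurable_normal_pdf.
  + by move=> E _ mE; rewrite -Radon_Nikodym_SigmaFinite.f_integral.
Qed.

Lemma integrable_normal_prob (f : R -> R) : gamma.-integrable setT (EFin \o f) ->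
  mu.-integrable setT (fun x => (f x * phi x)%:E).
Proof.
move=> /integrableP[/measurable_EFinP mf fi]; apply/integrableP; split.
  by apply/measurable_EFinP; apply: measurable_funM => //; exact: measurable_normal_pdf.
move: fi; rewrite ge0_integral_normal_prob//; last first.
  by apply: measurableT_comp => //; exact/measurable_EFinP.
apply: le_lt_trans; rewrite le_eqVlt; apply/orP; left; apply/eqP.
apply: eq_integral => x _ /=.
by rewrite normrM EFinM (ger0_norm (normal_pdf_ge0 _ _ _)).
Qed.

Lemma integral_normal_prob (f : R -> R) : gamma.-integrable setT (EFin \o f) ->
  (\int[gamma]_x (f x)%:E = \int[mu]_x (f x * phi x)%:E)%E.
Proof.
move=> fi; have fpi := integrable_normal_prob fi.
have /integrableP[mf _] := fi.
rewrite [LHS]integralE [RHS]integralE.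
rewrite !ge0_integral_normal_prob//; [|exact: measurable_funeneg|exact: measurable_funepos].
have p0 x : (0 <= (phi x)%:E)%E by rewrite lee_fin normal_pdf_ge0.
congr (_ - _)%E; apply: eq_integral => x _.
  by rewrite !funeposE EFinM maxe_pMl// mul0e.
by rewrite !funenegE EFinM -mulNe maxe_pMl// mul0e.
Qed.

Lemma normal_pdf01E (x : R) : phi x = normal_peak 1 * expR (- (x ^+ 2 / 2)).
Proof.
rewrite normal_pdfE ?oner_eq0// /normal_fun subr0 expr1n; congr (_ * expR _).
by rewrite mulNr.
Qed.

(** Since [y <= expR y] at [y = x ^+ 2 / 4], the function [x ^+ 2] times the
    standard normal density is dominated by a multiple of the normal density of
    variance 2. *)
Lemma integrable_normal_sqr : gamma.-integrable setT (fun x : R => (x ^+ 2)%:E).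
Proof.
have msq : measurable_fun setT (fun x : R => (x ^+ 2)%:E).
  by apply/measurable_EFinP; exact: measurable_funX.
apply/integrableP; split => //.
under eq_integral do rewrite /= ger0_norm ?sqr_ge0//.
rewrite ge0_integral_normal_prob//; last by move=> x; rewrite lee_fin sqr_ge0.
pose s : R := Num.sqrt 2.
have s2 : s ^+ 2 = 2 by rewrite sqr_sqrtr.
have s0 : s != 0 by rewrite gt_eqF// sqrtr_gt0.
pose c : R := 4 * normal_peak 1 / normal_peak s.
apply: (@le_lt_trans _ _ (\int[mu]_x (c%:E * (normal_pdf 0 s x)%:E))%E).
  apply: ge0_le_integral => //.
  - by move=> x _; rewrite -EFinM lee_fin mulr_ge0 ?sqr_ge0// normal_pdf_ge0.
  - by apply: emeasurable_funM => //; apply/measurable_EFinP; exact: measurable_normal_pdf.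
  - by apply: emeasurable_funM => //; apply/measurable_EFinP; exact: measurable_normal_pdf.
  - move=> x _; rewrite -!EFinM lee_fin normal_pdf01E normal_pdfE// /normal_fun subr0 s2.
    pose e := expR (- (x ^+ 2 / 4)).
    have -> : expR (- (x ^+ 2 / 2)) = e * e by rewrite -expRD; congr expR; field.
    have -> : expR (- x ^+ 2 / (2 *+ 2)) = e by congr expR; field.
    have xe : x ^+ 2 * e <= 4.
      rewrite /e expRN ler_pdivrMr ?expR_gt0//.
      have := expR_ge1Dx (x ^+ 2 / 4); lra.
    have -> : c * (normal_peak s * e) = normal_peak 1 * e * 4.
      by rewrite /c; field; rewrite gt_eqF// normal_peak_gt0.
    have -> : x ^+ 2 * (normal_peak 1 * (e * e)) = normal_peak 1 * e * (x ^+ 2 * e).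
      by ring.
    by apply: ler_wpM2l => //; rewrite mulr_ge0 ?normal_peak_ge0// expR_ge0.
rewrite integralZl//; last exact: integrable_normal_pdf.
by rewrite integral_normal_pdf mule1 ltry.
Qed.

Let is_derive_normal_pdf (x : R) : is_derive x (1 : R) phi (- x * phi x).
Proof.
have E : phi = (fun x => normal_peak 1 * expR (- (2^-1 * x ^+ 2))).
  by apply/funext => y; rewrite normal_pdf01E [2^-1 * _]mulrC.
by rewrite E; apply: is_derive_eq; rewrite /GRing.scale/=; field.
Qed.

(** A crude decay rate, enough to kill the boundary terms in [stein]. *)
Lemma normal_pdf_le_inv (m : R) : 0 < m -> phi m <= normal_peak 1 / m.
Proof.
move=> m0; rewrite normal_pdf01E; apply: ler_wpM2l; first exact: normal_peak_ge0.
rewrite expRN lef_pV2 ?posrE ?expR_gt0//.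
have := expR_ge1Dx (m ^+ 2 / 2); have := sqr_ge0 (m - 1); rewrite !expr2; lra.
Qed.

Lemma integrable_normal_stein (F F' : R -> R) (C : R) :
  continuous F -> continuous F' ->
  (forall x, `|F x| <= C) -> (forall x, `|F' x| <= C) ->
  gamma.-integrable setT (fun x => (x * F x - F' x)%:E).
Proof.
move=> cF cF' bF bF'.
have C0 : 0 <= C by exact: le_trans (bF 0).
have mg : measurable_fun setT (fun x : R => x * F x - F' x).
  by apply: measurable_funB; [apply: measurable_funM => //|];
    exact: continuous_measurable_fun.
apply: (@le_integrable _ _ _ gamma _ _ _ (fun x => (C * 2)%:E + C%:E * (x ^+ 2)%:E)%E) => //.
- exact/measurable_EFinP.
- move=> x _; rewrite -EFinM -EFinD !abse_EFin lee_fin.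
  rewrite [leRHS]ger0_norm; last by rewrite addr_ge0// mulr_ge0// sqr_ge0.
  apply: le_trans (ler_normB _ _) _; rewrite normrM.
  have h1 := bF x; have h2 := bF' x.
  have h3 : `|x| <= 1 + x ^+ 2.
    have := sqr_ge0 (`|x| - 1); have := real_normK (num_real x).
    have := normr_ge0 x; rewrite !expr2; nra.
  have : `|x| * `|F x| <= (1 + x ^+ 2) * C by apply: ler_pM.
  nra.
- apply: integrableD => //; first exact: finite_measure_integrable_cst.
  by apply: integrableZl => //; exact: integrable_normal_sqr.
Qed.

(** The density satisfies [phi' = - x * phi], so the integrand against [phi] is
    the derivative of [- (F * phi)].  The fundamental theorem on [[-n, n]] leaves
    boundary terms that vanish with [phi], and dominated convergence gives the
    integral over the line. *)
Lemma stein (F F' : R -> R) (C : R) :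
  (forall x : R, is_derive x (1 : R) F (F' x)) -> continuous F' ->
  (forall x, `|F x| <= C) -> (forall x, `|F' x| <= C) ->
  (\int[gamma]_x (x * F x - F' x)%:E = 0)%E.
Proof.
move=> dF cF' bF bF'.
have cF : continuous F.
  move=> x; apply/differentiable_continuous/derivable1_diffP.
  by have [] := dF x.
have cphi : continuous phi by apply: continuous_normal_pdf; exact: oner_neq0.
have C0 : 0 <= C by exact: le_trans (bF 0).
have ig := integrable_normal_stein cF cF' bF bF'.
rewrite (integral_normal_prob ig).
have igp := integrable_normal_prob ig.
pose gp x : R := (x * F x - F' x) * phi x.
have cgp : continuous gp.
  move=> x; apply: cvgM; last exact: cphi.
  by apply: cvgB; [apply: cvgM; [exact: cvg_id|exact: cF]|exact: cF'].
pose I n := `[- n.+1%:R, n.+1%:R : R]%classic.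
pose H x := - (F x * phi x).
have dH x : is_derive x (1 : R) H (gp x).
  have h1 := dF x; have h2 := is_derive_normal_pdf x.
  by rewrite /H; apply: is_derive_eq; rewrite /gp /GRing.scale/=; ring.
have In n : (\int[mu]_(x in I n) (gp x)%:E = (H n.+1%:R - H (- n.+1%:R))%:E)%E.
  have cH : continuous H.
    by move=> x; apply/differentiable_continuous/derivable1_diffP; have [] := dH x.
  rewrite (@continuous_FTC2 _ gp H) ?EFinB//.
  - by rewrite gtrN// ltr0n.
  - exact: continuous_subspaceT.
  - split; first by move=> x _; have [] := dH x.
    + exact/cvg_at_right_filter/cH.
    + exact/cvg_at_left_filter/cH.
  - by move=> x _; rewrite derive1E; have [_ ->] := dH x.
have cv1 : (\int[mu]_(x in I n) (gp x)%:E)%E @[n --> \oo] --> (\int[mu]_x (gp x)%:E)%E.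
  under eq_fun do rewrite integral_mkcond.
  apply: (@dominated_cvg _ _ _ mu setT measurableT _ _ (fun x => `|(gp x)%:E|%E)).
  - move=> n; apply/measurable_restrict => //; first exact: measurable_itv.
    exact: measurable_funTS (measurable_int _ igp).
  - move=> x _; apply: cvg_near_cst; near=> n.
    rewrite patchE mem_set// /I/= in_itv/= -ler_norml.
    near: n; exists (Num.truncn `|x|) => // n /= xn.
    apply: ltW; apply: lt_le_trans (truncnS_gt _) _.
    by rewrite ler_nat ltnS.
  - by [].
  - exact: integrable_abse.
  - move=> n x _ /=; rewrite patchE; case: ifP => // _.
    by rewrite (_ : point = 0%E)// abse0 lee_fin.
have cv2 : (\int[mu]_(x in I n) (gp x)%:E)%E @[n --> \oo] --> 0%E.
  under eq_fun do rewrite In.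
  apply: cvg_EFin; first exact: nearW.
  rewrite /comp/=; apply/norm_cvg0P.
  pose K : R := 2 * C * normal_peak 1.
  apply: (@squeeze_cvgr _ _ _ _ (cst 0) (fun n => K * harmonic n)).
  - near=> n; rewrite normr_ge0/=.
    have phiE : phi (- n.+1%:R) = phi n.+1%:R by rewrite !normal_pdf01E sqrrN.
    have hp : phi n.+1%:R <= normal_peak 1 / n.+1%:R by apply: normal_pdf_le_inv; rewrite ltr0n.
    have p0 : 0 <= phi n.+1%:R by exact: normal_pdf_ge0.
    rewrite /H phiE -opprD -mulrBl normrN normrM (ger0_norm p0).
    have -> : K * harmonic n = (C + C) * (normal_peak 1 / n.+1%:R).
      by rewrite /K /harmonic/=; ring.
    apply: ler_pM => //; apply: le_trans (ler_normB _ _) _.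
    by apply: lerD.
  - exact: cvg_cst.
  - rewrite -[X in _ --> X](mulr0 K); apply: cvgM; first exact: cvg_cst.
    exact: cvg_harmonic.
exact: cvg_unique cv1 cv2.
Unshelve. all: by end_near. Qed.

End normal_integral.

(** * Independence of one variable from all the others *)

Section independence.
Context d (T : measurableType d) (R : realType) (P : probability T R).
Variables (I J : finType) (X : I -> {RV P >-> R}) (Y : J -> {RV P >-> R}).
Variable i : I.
Hypothesis indX : mutually_independent X.
Hypothesis indXY : independent_families X Y.

(** Generators of the sigma-algebra of all the variables but [X i]. *)
Definition other_events : set (set T) :=
  (\bigcup_(k in [set k | k != i]) preimage_set_system setT (X k) measurable) `|`
  (\bigcup_j preimage_set_system setT (Y j) measurable).

Let SY := g_sigma_algebraType (\bigcup_j preimage_set_system setT (Y j) measurable).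

(** A pi-system generating the same sigma-algebra, on whose elements the two
    independence hypotheses give the product rule directly. *)
Let cylinder : set (set T) := [set B | exists (A : I -> set R) (N : set T),
  [/\ forall k, measurable (A k), sigma_of Y N &
      B = (\bigcap_(k in [set` [set~ i]%SET]) (X k @^-1` A k)) `&` N]].

Let cylinder_setI : setI_closed cylinder.
Proof.
move=> _ _ [A1 [N1 [mA1 sN1 ->]]] [A2 [N2 [mA2 sN2 ->]]].
exists (fun k => A1 k `&` A2 k), (N1 `&` N2); split.
- by move=> k; exact: measurableI.
- exact: (@measurableI _ SY).
- apply/seteqP; split => t /=.
    move=> [[h1 n1] [h2 n2]]; split=> // k kI.
    by split; [exact: h1|exact: h2].
  by move=> [h [n1 n2]]; split; split=> // k kI; have [] := h k kI.
Qed.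

Let sigmaY_measurable N : sigma_of Y N -> measurable N.
Proof.
apply: smallest_sub; first exact: sigma_algebra_measurable.
by move=> _ [j _ [A mA <-]]; exact: measurable_funPT.
Qed.

Let cylinder_measurable : cylinder `<=` measurable.
Proof.
move=> _ [A [N [mA sN ->]]]; apply: measurableI; last exact: sigmaY_measurable.
apply: fin_bigcap_measurable => // k _.
by rewrite -[X in measurable X]setTI; exact: measurable_funPT.
Qed.

Let cylinder_indep (A : set R) : measurable A -> forall B, cylinder B ->
  P (X i @^-1` A `&` B) = (P (X i @^-1` A) * P B)%E.
Proof.
move=> mA _ [A_ [N [mA_ sN ->]]].
pose A' k := if k == i then A else A_ k.
have mA' k : measurable (A' k) by rewrite /A'; case: ifP.
have sX k (B : set R) : measurable B -> sigma_of X (X k @^-1` B).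
  move=> mB; apply: sub_sigma_algebra; exists k => //.
  by exists B => //; rewrite setTI.
pose SX := g_sigma_algebraType (\bigcup_j preimage_set_system setT (X j) measurable).
have sXcap (L : {set I}) (B : I -> set R) : (forall k, measurable (B k)) ->
    sigma_of X (\bigcap_(k in [set` L]) (X k @^-1` B k)).
  by move=> mB; apply: (@fin_bigcap_measurable _ SX) => // k _; exact: sX.
have E : X i @^-1` A `&` (\bigcap_(k in [set` [set~ i]%SET]) (X k @^-1` A_ k)) =
    \bigcap_(k in [set` [set: I]%SET]) (X k @^-1` A' k).
  apply/seteqP; split => t /=.
    move=> [Ai h] k _ /=; rewrite /A'; case: eqP => [->//|/eqP ki].
    by apply: h; rewrite /= !inE.
  move=> h; split; first by have := h i; rewrite /= /A' eqxx; apply; rewrite inE.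
  move=> k /=; rewrite !inE => ki; have := h k.
  by rewrite /= /A' (negbTE ki); apply; rewrite inE.
rewrite setIA E (indXY (sXcap _ _ mA') sN) (indX _ mA').
rewrite (indXY (sXcap _ _ mA_) sN) (indX _ mA_) muleA; congr (_ * _)%E.
rewrite (bigD1 i) ?inE//= {1}/A' eqxx; congr (_ * _)%E.
by apply: eq_big => [k|k /andP[_ ki]]; rewrite ?inE// /A' (negbTE ki).
Qed.

Lemma other_events_measurable : other_events `<=` measurable.
Proof. by move=> B [[k _ [A mA <-]]|[j _ [A mA <-]]]; exact: measurable_funPT. Qed.

(** Both sides are finite measures in [B], so it is enough to compare them on
    cylinders. *)
Lemma independent_of_others (A : set R) : measurable A ->
  forall B, <<s other_events >> B ->
  P (X i @^-1` A `&` B) = (P (X i @^-1` A) * P B)%E.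
Proof.
move=> mA B sB.
have mXA : measurable (X i @^-1` A).
  by rewrite -[X in measurable X]setTI; exact: measurable_funPT.
have SYT : sigma_of Y setT by exact: (@measurableT _ SY).
have cT : cylinder setT.
  exists (fun=> setT), setT; split => //.
  by apply/seteqP; split => // t _.
have sB' : <<s cylinder >> B.
  move: B sB; apply: smallest_sub; first exact: smallest_sigma_algebra.
  move=> B [[k /= ki [C mC <-]]|YB]; apply: sub_sigma_algebra.
    exists (fun l => if l == k then C else setT), setT; split => //.
      by move=> l; case: ifP.
    rewrite setTI setIT; apply/seteqP; split => t /= h.
      by move=> l _ /=; case: eqP => [->|].
    by have := h k; rewrite /= eqxx; apply; rewrite !inE.
  exists (fun=> setT), B; split => //; first exact: sub_sigma_algebra.
  by rewrite (_ : \bigcap_(_ in _) _ = setT) ?setTI//; apply/seteqP; split.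
have fA : P (X i @^-1` A) \is a fin_num by exact: fin_num_measure.
have fA0 : 0 <= fine (P (X i @^-1` A)) by exact: fine_ge0.
pose m1 : {measure set T -> \bar R} := mrestr P mXA.
pose m2 : {measure set T -> \bar R} := mscale (NngNum fA0) P.
have m2E C : m2 C = (P (X i @^-1` A) * P C)%E.
  by rewrite /m2/= /mscale; congr (_ * _)%E; exact: fineK.
rewrite -m2E setIC -[LHS]/(m1 B).
apply: (g_sigma_algebra_measure_unique cylinder cylinder_measurable
  (fun=> setT) (fun=> cT) _ m1 m2 cylinder_setI _ _ B sB').
- by rewrite bigcup_const//; exists 0%N.
- by move=> C cC; rewrite m2E /m1/= /mrestr setIC; exact: cylinder_indep.
- by move=> _; rewrite /m1/= /mrestr setTI ltey_eq fA.
Qed.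

End independence.

Section independent_fibers.
Context d1 d (T1 : measurableType d1) (T : measurableType d) (R : realType).
Variables (P : probability T R) (Q : probability T1 R) (X : T -> T1).
Hypothesis mX : measurable_fun setT X.
Variable E : set (set T).
Hypothesis mE : E `<=` measurable.
Hypothesis lawX : forall A, measurable A -> P (X @^-1` A) = Q A.
Hypothesis indX : forall A B, measurable A -> <<s E >> B ->
  P (X @^-1` A `&` B) = (P (X @^-1` A) * P B)%E.

Local Notation T' := (g_sigma_algebraType E).

(** The second coordinate is the sample point itself, seen through the
    sigma-algebra generated by [E].  The pair [(X t, t)] then has a product law,
    and Fubini's theorem integrates [X] out first.  This conditions on all the
    other variables without naming a space in which they take their values. *)
Lemma integral_independent_fibers0 (h : T1 * T -> R) :
  measurable_fun (setT : set (T1 * T')) h ->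
  P.-integrable setT (fun t => (h (X t, t))%:E) ->
  (forall t, \int[Q]_x (h (x, t))%:E = 0)%E ->
  (\int[P]_t (h (X t, t))%:E = 0)%E.
Proof.
move=> mh ih h0.
have mid : measurable_fun setT (fun t : T => t : T').
  move=> _ B sB; rewrite setTI preimage_id; move: B sB.
  by apply: smallest_sub => //; exact: sigma_algebra_measurable.
have mXid : measurable_fun setT (fun t : T => (X t, t) : T1 * T').
  exact: measurable_fun_pair.
pose idT' : {mfun T >-> T'} := mfun_Sub (mem_set mid).
pose pairT : {mfun T >-> (T1 * T')%type} := mfun_Sub (mem_set mXid).
have prodE A : measurable A -> (Q \x distribution P idT')%E A = distribution P pairT A.
  apply: product_measure_unique => B C mB mC.
  by apply: etrans (indX mB mC) _; rewrite (lawX mB); reflexivity.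
have mhE : measurable_fun (setT : set (T1 * T')) (EFin \o h) by exact/measurable_EFinP.
have ihp : (distribution P pairT).-integrable setT (EFin \o h).
  exact: integrable_pushforward.
have ihQ : (Q \x distribution P idT')%E.-integrable setT (EFin \o h).
  apply/integrableP; split => //.
  have /integrableP[_] := ihp; apply: le_lt_trans.
  rewrite (eq_measure_integral (distribution P pairT)) => [//|A mA _].
  exact: prodE.
transitivity (\int[distribution P pairT]_z (EFin \o h) z)%E.
  by rewrite integral_distribution.
rewrite (eq_measure_integral (Q \x distribution P idT')%E) => [|A mA _].
  rewrite -integral21_prod_meas1//.
  by apply: integral0_eq => t _; exact: h0.
by symmetry; exact: prodE.
Qed.

End independent_fibers.

(** * Square integrable variables *)

Section integrable_real.
Context d (T : measurableType d) (R : realType) (P : probability T R).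
Implicit Types f g : T -> R.

Local Notation integrable f := (P.-integrable setT (EFin \o f)).

Lemma integrable_add f g : integrable f -> integrable g ->
  integrable (fun t => f t + g t).
Proof. by move=> hf hg; exact: (integrableD measurableT hf hg). Qed.

Lemma integrable_sub f g : integrable f -> integrable g ->
  integrable (fun t => f t - g t).
Proof. by move=> hf hg; exact: (integrableB measurableT hf hg). Qed.

Lemma integrable_scale c f : integrable f -> integrable (fun t => c * f t).
Proof. by move=> hf; exact: (integrableZl measurableT c hf). Qed.

Lemma integrable_sumr (I : Type) (s : seq I) (Q : pred I) (f : I -> T -> R) :
  (forall i, integrable (f i)) -> integrable (fun t => \sum_(i <- s | Q i) f i t).
Proof.
move=> hf; apply: (eq_integrable measurableT
    (fun t => \sum_(i <- s | Q i) (f i t)%:E)%E).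
  by move=> t _; rewrite /= sumEFin.
by apply: integrable_sum => // i _; exact: hf.
Qed.

Lemma integrable_le f g : measurable_fun setT f -> integrable g ->
  (forall t, `|f t| <= `|g t|) -> integrable f.
Proof.
move=> mf hg fg; apply: (le_integrable measurableT _ _ hg).
  exact/measurable_EFinP.
by move=> t _ /=; rewrite lee_fin.
Qed.

Lemma integrable_bounded (C : R) f : measurable_fun setT f ->
  (forall t, `|f t| <= C) -> integrable f.
Proof.
move=> mf fC; apply: (@integrable_le _ (cst C)) => //.
  exact: finite_measure_integrable_cst.
by move=> t /=; apply: le_trans (fC t) _; exact: ler_norm.
Qed.

Lemma integrable_mul f g : measurable_fun setT f -> measurable_fun setT g ->
  integrable (fun t => f t ^+ 2) -> integrable (fun t => g t ^+ 2) ->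
  integrable (fun t => f t * g t).
Proof.
move=> mf mg hf hg; apply: integrable_le (integrable_add hf hg) _.
  exact: measurable_funM.
move=> t; rewrite [leRHS]ger0_norm ?addr_ge0 ?sqr_ge0// normrM.
have := sqr_ge0 (`|f t| - `|g t|).
rewrite -[f t ^+ 2]real_normK ?num_real// -[g t ^+ 2]real_normK ?num_real//.
have := normr_ge0 (f t); have := normr_ge0 (g t); rewrite !expr2; nra.
Qed.

Lemma Rintegral_sum (I : Type) (s : seq I) (Q : pred I) (f : I -> T -> R) :
  (forall i, integrable (f i)) ->
  \int[P]_t (\sum_(i <- s | Q i) f i t) = \sum_(i <- s | Q i) \int[P]_t f i t.
Proof.
move=> hf; elim: s => [|i s ih].
  under eq_Rintegral do rewrite big_nil.
  by rewrite Rintegral_cst// mul0r big_nil.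
under eq_Rintegral do rewrite big_cons.
rewrite big_cons; case: ifP => // _.
by rewrite RintegralD// ?ih//; exact: integrable_sumr.
Qed.

(** Nonnegativity of the mean of [(f - 'E_P[f] - l * S) ^+ 2]. *)
Lemma variance_lower_bound (C l : R) f (S : T -> R) :
  measurable_fun setT f -> (forall t, `|f t| <= C) ->
  measurable_fun setT S -> integrable (fun t => S t ^+ 2) ->
  ((2 * l * \int[P]_t (S t * (f t - fine 'E_P[f])) -
     l ^+ 2 * \int[P]_t (S t ^+ 2))%:E <= 'V_P[f])%E.
Proof.
move=> mf fC mS iS2; set m := fine 'E_P[f].
have mg : measurable_fun setT (fun t => f t - m) by exact: measurable_funB.
have ig2 : integrable (fun t => (f t - m) ^+ 2).
  apply: (@integrable_bounded ((C + `|m|) ^+ 2)); first exact: measurable_funX.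
  move=> t; rewrite normrX lerXn2r ?nnegrE ?normr_ge0//.
    by rewrite addr_ge0// (le_trans _ (fC t)).
  by apply: le_trans (ler_normB _ _) _; rewrite lerD2r.
have iSg : integrable (fun t => S t * (f t - m)) by exact: integrable_mul.
have -> : 'V_P[f] = (\int[P]_t ((f t - m) ^+ 2))%:E.
  rewrite /Rintegral fineK; last exact: (integrable_fin_num measurableT ig2).
  by rewrite /m /variance covariance.unlock expectation.unlock.
rewrite lee_fin -subr_ge0.
have -> : \int[P]_t ((f t - m) ^+ 2) - (2 * l * \int[P]_t (S t * (f t - m)) -
    l ^+ 2 * \int[P]_t (S t ^+ 2)) = \int[P]_t ((f t - m - l * S t) ^+ 2).
  transitivity (\int[P]_t ((f t - m) ^+ 2 - (2 * l * (S t * (f t - m)) -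
    l ^+ 2 * (S t ^+ 2)))).
    have h1 := integrable_scale (2 * l) iSg.
    have h2 := integrable_scale (l ^+ 2) iS2.
    rewrite RintegralB//; last exact: (integrable_sub h1 h2).
    by rewrite RintegralB// !RintegralZl.
  by apply: eq_Rintegral => t _; ring.
by apply: Rintegral_ge0 => t _; exact: sqr_ge0.
Qed.

(** Continuity from above along sets decreasing to the empty set. *)
Lemma small_tail f (e : R) : measurable_fun setT f -> 0 < e ->
  exists n0 : nat, forall n, (n0 <= n)%N ->
    (P [set t | (n%:R < `|f t|)%R] <= e%:E)%E.
Proof.
move=> mf e0; pose F n := [set t | n%:R < `|f t|].
have mF n : measurable (F n).
  rewrite -[F n]setTI; rewrite (_ : F n = (fun t => `|f t|) @^-1` `]n%:R, +oo[).
    have mn : measurable_fun setT (fun t => `|f t|) by exact: measurableT_comp.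
    by apply: mn => //; exact: measurable_itv.
  by apply/seteqP; split => t; rewrite /F/= in_itv/= andbT.
have : P (F n) @[n --> \oo] --> P (\bigcap_n F n).
  apply: nonincreasing_cvg_mu => //.
  - by rewrite ltey_eq fin_num_measure.
  - exact: bigcap_measurable.
  - move=> n m nm; apply/subsetPset => t; rewrite /F/=; apply: le_lt_trans.
    by rewrite ler_nat.
have -> : \bigcap_n F n = set0.
  rewrite -subset0 => t h; have := h (Num.truncn `|f t|).+1 Logic.I.
  by rewrite /F/= ltNge (ltW (truncnS_gt _)).
rewrite measure0 => /fine_cvgP[_ /cvgrPdist_lt/(_ e e0)[n0 _ h]].
exists n0 => n /h /=; rewrite sub0r normrN ger0_norm ?fine_ge0// => /ltW.
by rewrite -lee_fin fineK// fin_num_measure.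
Qed.

End integrable_real.

(** * Families of independent standard normal variables *)

Section gaussian_family.
Context d (T : measurableType d) (R : realType) (P : probability T R).
Variables (I J : finType) (X : I -> {RV P >-> R}) (Y : J -> {RV P >-> R}).
Hypothesis iidX : iid X (normal_prob 0 1).
Hypothesis indXY : independent_families X Y.

Local Notation gamma := (@normal_prob R 0 1).
Local Notation others i := (g_sigma_algebraType (other_events X Y i)).

Definition normal_second_moment : R := \int[gamma]_x (x ^+ 2).

Let lawX i (A : set (measurableTypeR R)) : measurable A -> P (X i @^-1` A) = gamma A.
Proof. by move=> mA; exact: iidX.2 i A mA. Qed.

Let mXR i : measurable_fun setT (X i : T -> measurableTypeR R).
Proof. by have h : measurable_fun setT (X i) by []; exact: h. Qed.

(** Stein's identity in the variable [X i], with the other variables frozen. *)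
Lemma gaussian_integration_by_parts i (F F' : R -> T -> R) :
  measurable_fun (setT : set (measurableTypeR R * others i)) (fun z => F z.1 z.2) ->
  measurable_fun (setT : set (measurableTypeR R * others i)) (fun z => F' z.1 z.2) ->
  (forall t (x : R), is_derive x (1 : R) (F^~ t) (F' x t)) ->
  (forall t, continuous (F'^~ t)) ->
  (forall t, exists C, forall x, `|F x t| <= C /\ `|F' x t| <= C) ->
  P.-integrable setT (fun t => (X i t * F (X i t) t - F' (X i t) t)%:E) ->
  (\int[P]_t (X i t * F (X i t) t - F' (X i t) t)%:E = 0)%E.
Proof.
move=> mF mF' dF cF' bF iF.
apply: (@integral_independent_fibers0 _ _ _ _ _ P gamma (X i) (mXR i)
   (other_events X Y i) (@other_events_measurable _ _ _ _ _ _ X Y i) (lawX i) _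
   (fun z => z.1 * F z.1 z.2 - F' z.1 z.2)) => //.
- by move=> A B mA; exact: independent_of_others iidX.1 indXY _ mA _.
- by apply: measurable_funB => //; exact: measurable_funM.
- move=> t; have [C hC] := bF t.
  apply: (@stein _ (F^~ t) (F'^~ t) C); [exact: cF'| |].
    by move=> x; have [] := hC x.
  by move=> x; have [] := hC x.
Qed.

Lemma gaussian_sqr i : P.-integrable setT (fun t => (X i t ^+ 2)%:E) /\
  \int[P]_t (X i t ^+ 2) = normal_second_moment.
Proof.
have msq : measurable_fun (setT : set (measurableTypeR R)) (fun x : R => (x ^+ 2)%:E).
  exact: measurable_int (@integrable_normal_sqr R).
have E : (\int[P]_t (X i t ^+ 2)%:E = \int[gamma]_x (x ^+ 2)%:E)%E.
  have := @ge0_integral_pushforward _ _ T (measurableTypeR R) R _ (mXR i) P setT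
     (fun x : R => (x ^+ 2)%:E) measurableT msq.
  rewrite preimage_setT => <-; last by move=> x _; rewrite lee_fin sqr_ge0.
  by apply: eq_measure_integral => A mA _; exact: lawX.
split; last by rewrite /Rintegral E.
apply/integrableP; split.
  by apply/measurable_EFinP; apply: measurable_funX; exact: measurable_funPT.
under eq_integral do rewrite /= ger0_norm ?sqr_ge0//.
by rewrite E; apply: integrable_lty => //; exact: integrable_normal_sqr.
Qed.

Lemma gaussian_cross_integrable i k :
  P.-integrable setT (fun t => (X i t * X k t)%:E).
Proof.
apply: (@integrable_mul _ _ _ P (X i) (X k)); try exact: measurable_funPT.
  by have [] := gaussian_sqr i.
by have [] := gaussian_sqr k.
Qed.

Lemma measurable_other i k : k != i ->
  measurable_fun setT (X k : others i -> R).
Proof.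
move=> ki _ A mA; rewrite setTI; apply: sub_sigma_algebra; left.
by exists k => //; exists A => //; rewrite setTI.
Qed.

Lemma measurable_otherY i j : measurable_fun setT (Y j : others i -> R).
Proof.
move=> _ A mA; rewrite setTI; apply: sub_sigma_algebra; right.
by exists j => //; exists A => //; rewrite setTI.
Qed.

(** Integration by parts for a function that is constant in [X i]. *)
Lemma gaussian_uncorrelated i k : i != k -> \int[P]_t (X i t * X k t) = 0.
Proof.
move=> ik.
have := @gaussian_integration_by_parts i (fun _ t => X k t) (fun _ _ => 0).
rewrite /Rintegral => h.
suff -> : (\int[P]_t (X i t * X k t)%:E = 0)%E by [].
under eq_integral do rewrite -[X i _ * _]subr0.
apply: h.
- apply: (@measurableT_comp _ _ _ _ _ _ (X k : others i -> R)) => //.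
    by apply: measurable_other; rewrite eq_sym.
- exact: measurable_cst.
- by move=> t x; exact: cvg_cst.
- by move=> t; exists `|X k t| => x; rewrite normr0.
- under eq_fun do rewrite subr0; exact: gaussian_cross_integrable.
Qed.

Lemma gaussian_sum_sqr :
  P.-integrable setT (fun t => ((\sum_i X i t) ^+ 2)%:E) /\
  \int[P]_t ((\sum_i X i t) ^+ 2) = #|I|%:R * normal_second_moment.
Proof.
have E t : (\sum_i X i t) ^+ 2 = \sum_i \sum_k X i t * X k t.
  by rewrite expr2 big_distrlr.
have h i k := gaussian_cross_integrable i k.
have h' i : P.-integrable setT (EFin \o (fun t => \sum_k X i t * X k t)).
  by apply: (@integrable_sumr _ _ _ P) => k; exact: h.
split.
  under eq_fun do rewrite E.
  by apply: (@integrable_sumr _ _ _ P) => i; exact: h'.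
under eq_Rintegral do rewrite E.
rewrite Rintegral_sum//.
transitivity (\sum_(i in I) normal_second_moment).
  apply: eq_bigr => i _; rewrite Rintegral_sum; last by move=> k; exact: h.
  rewrite (bigD1 i)//= big1 ?addr0 => [|k ki]; last first.
    by rewrite gaussian_uncorrelated// eq_sym.
  rewrite -(gaussian_sqr i).2; by apply: eq_Rintegral => t _; rewrite expr2.
by rewrite sumr_const mulr_natl.
Qed.

End gaussian_family.

(** * The mean size of a random matching *)

Section gibbs_measurability.
Context (R : realType) (G : sgraph) d (T : measurableType d).
Variables (w : edge G -> T -> R) (nu : G -> T -> R).
Hypothesis mw : forall a, measurable_fun setT (w a).
Hypothesis mnu : forall x, measurable_fun setT (nu x).

Let mboltzmann M :
  measurable_fun setT (fun t => boltzmann (w^~ t) (nu^~ t) M).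
Proof.
apply: measurableT_comp => //; apply: measurable_funD.
  under eq_fun do rewrite big_mkcond/=; apply: measurable_sum => a.
  by case: (a \in M) => //; exact: measurable_cst.
under eq_fun do rewrite big_mkcond/=; apply: measurable_sum => x.
by case: (x \in unmatched M) => //; exact: measurable_cst.
Qed.

Lemma measurable_gibbs f :
  measurable_fun setT (fun t => gibbs_expectation (w^~ t) (nu^~ t) f).
Proof.
rewrite (_ : (fun t => _) = (fun t =>
    (\sum_(M in matchings G) boltzmann (w^~ t) (nu^~ t) M * f M) *
    partition_function (w^~ t) (nu^~ t) `^ (-1))); last first.
  apply/funext => t; rewrite gibbs_expectationE powR_inv1//.
  exact: ltW (partition_function_gt0 _ _).
apply: measurable_funM.
  under eq_fun do rewrite big_mkcond/=; apply: measurable_sum => M.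
  case: (M \in matchings G); last exact: measurable_cst.
  by apply: measurable_funM => //; exact: measurable_cst.
apply: (measurableT_comp (measurable_powR _)).
under eq_fun do rewrite /partition_function big_mkcond/=.
apply: measurable_sum => M.
by case: (M \in matchings G) => //; exact: measurable_cst.
Qed.

Lemma measurable_gibbs_covariance f g :
  measurable_fun setT (fun t => gibbs_covariance (w^~ t) (nu^~ t) f g).
Proof.
apply: measurable_funB; first exact: measurable_gibbs.
by apply: measurable_funM; exact: measurable_gibbs.
Qed.

End gibbs_measurability.

Section monomer_dimer.
Context (R : realType) (G : sgraph) d (T : measurableType d) (P : probability T R).
Variables (w : edge G -> {RV P >-> R}) (nu : G -> {RV P >-> R}).
Hypothesis iidw : iid w (normal_prob 0 1).
Hypothesis indwnu : independent_families w nu.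

Local Notation weights t := (fun a => w a t).
Local Notation fields t := (fun x => nu x t).
Local Notation card := (fun M : {set edge G} => #|M|%:R : R).
Local Notation mean_size := (fun t : T => gibbs_expectation (weights t) (fields t) card).
Local Notation N := (#|{: edge G}|%:R : R).

Let cardN M : `|card M| <= N.
Proof. by rewrite ger0_norm// ler_nat max_card. Qed.

Let mwP a : measurable_fun setT (w a). Proof. by []. Qed.
Let mnuP x : measurable_fun setT (nu x). Proof. by []. Qed.

(** Integration by parts in the weight of [a]; the constant [m] does not affect
    the derivative. *)
Lemma gibbs_covariance_derivative a (m : R) :
  P.-integrable setT (fun t => (w a t * (mean_size t - m))%:E) /\
  \int[P]_t (w a t * (mean_size t - m)) =
  \int[P]_t gibbs_covariance (weights t) (fields t) (fun M => (a \in M)%:R) card.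
Proof.
pose F x t := gibbs_expectation (set_weight (weights t) a x) (fields t) card - m.
pose F' x t := gibbs_covariance (set_weight (weights t) a x) (fields t)
  (fun M => (a \in M)%:R) card.
have wE t : set_weight (weights t) a (w a t) = weights t.
  by apply/funext => b; rewrite /set_weight; case: eqP => [->|].
have FE t : F (w a t) t = mean_size t - m by rewrite /F wE.
have F'E t : F' (w a t) t =
    gibbs_covariance (weights t) (fields t) (fun M => (a \in M)%:R) card.
  by rewrite /F' wE.
have mF : measurable_fun setT (fun t => mean_size t - m).
  by apply: measurable_funB => //; exact: (measurable_gibbs mwP mnuP).
have mF' : measurable_fun setT (fun t => F' (w a t) t).
  under eq_fun do rewrite F'E.
  exact: (measurable_gibbs_covariance mwP mnuP).
have i1 : P.-integrable setT (fun t => (w a t * (mean_size t - m))%:E).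
  apply: (@integrable_mul _ _ _ P (w a)) => //.
    by have [] := gaussian_sqr iidw a.
  apply: (@integrable_bounded _ _ _ P ((N + `|m|) ^+ 2)); first exact: measurable_funX.
  move=> t; rewrite normrX lerXn2r ?nnegrE ?normr_ge0 ?addr_ge0//.
  by apply: le_trans (ler_normB _ _) _; rewrite lerD2r gibbs_norm_le.
have i2 : P.-integrable setT (EFin \o (fun t => F' (w a t) t)).
  apply: (@integrable_bounded _ _ _ P (2 * N)) => // t.
  exact: gibbs_covariance_norm_le.
split => //; under [RHS]eq_Rintegral do rewrite -F'E.
apply/eqP; rewrite -subr_eq0 -RintegralB//; apply/eqP.
suff h : (\int[P]_t (w a t * F (w a t) t - F' (w a t) t)%:E = 0)%E.
  rewrite /Rintegral; transitivity (fine (\int[P]_t (w a t * F (w a t) t - F' (w a t) t)%:E)%E).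
    by congr fine; apply: eq_integral => t _; rewrite FE.
  by rewrite h.
have mcoord b : measurable_fun
    (setT : set (measurableTypeR R * g_sigma_algebraType (other_events w nu a)))
    (fun z => set_weight (weights z.2) a z.1 b).
  rewrite /set_weight; have [_|ba] := eqVneq b a; first exact: measurable_fst.
  apply: (@measurableT_comp _ _ _ _ _ _ (w b : g_sigma_algebraType _ -> R)) => //.
  exact: measurable_other.
have mfield x : measurable_fun
    (setT : set (measurableTypeR R * g_sigma_algebraType (other_events w nu a)))
    (fun z => nu x z.2).
  apply: (@measurableT_comp _ _ _ _ _ _ (nu x : g_sigma_algebraType _ -> R)) => //.
  exact: measurable_otherY.
apply: (gaussian_integration_by_parts iidw indwnu).
- by apply: measurable_funB => //; exact: (measurable_gibbs mcoord mfield).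
- exact: (measurable_gibbs_covariance mcoord mfield).
- move=> t x; rewrite /F -[F' x t]subr0; apply: is_deriveB.
  exact: is_derive_gibbs.
- by move=> t; exact: continuous_gibbs_covariance.
- move=> t; exists (2 * N + `|m|) => x; split.
    apply: le_trans (ler_normB _ _) _; rewrite lerD2r.
    by apply: le_trans (gibbs_norm_le _ _ cardN) _; rewrite ler_peMl// ler1n.
  by apply: le_trans (gibbs_covariance_norm_le _ _ a cardN) _; rewrite lerDl.
- under eq_fun do rewrite FE.
  exact: (@integrable_sub _ _ _ P).
Qed.

(** Summed over the edges, the indicators in [gibbs_covariance_derivative] add up
    to the size of the matching. *)
Lemma variance_mean_size_ge (l : R) :
  ((2 * l * \int[P]_t gibbs_covariance (weights t) (fields t) card card -
    l ^+ 2 * (N * normal_second_moment R))%:E <= 'V_P[mean_size])%E.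
Proof.
pose S t := \sum_a w a t.
have mS : measurable_fun setT S by exact: measurable_sum.
have [iS2 ES2] := gaussian_sum_sqr iidw indwnu.
have := @variance_lower_bound _ _ _ P N l mean_size S
  (measurable_gibbs mwP mnuP card) (fun t => gibbs_norm_le _ _ cardN) mS iS2.
rewrite ES2; set m := fine _; move=> h; apply: le_trans h; rewrite lee_fin.
apply: lerB => //; rewrite le_eqVlt; apply/orP; left; apply/eqP; congr (_ * _).
transitivity (\int[P]_t \sum_a (w a t * (mean_size t - m))); last first.
  by apply: eq_Rintegral => t _; rewrite /S big_distrl.
rewrite Rintegral_sum; last by move=> a; have [] := gibbs_covariance_derivative a m.
transitivity (\sum_a \int[P]_t gibbs_covariance (weights t) (fields t)
    (fun M => (a \in M)%:R) card); last first.
  by apply: eq_bigr => a _; have [_ ->] := gibbs_covariance_derivative a m.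
rewrite -Rintegral_sum; last first.
  move=> a; apply: (@integrable_bounded _ _ _ P (2 * N)) => [|t].
    exact: (measurable_gibbs_covariance mwP mnuP).
  exact: gibbs_covariance_norm_le.
apply: eq_Rintegral => t _; rewrite /gibbs_covariance sumrB -gibbs_sum.
have cE M : card M = \sum_a (a \in M)%:R.
  by rewrite -natr_sum -big_mkcond/= sum1_card.
rewrite -big_distrl/= -gibbs_sum; congr (_ - _ * _).
  by apply: eq_gibbs => M _; rewrite {1}cE big_distrl.
by apply: eq_gibbs => M _; exact: cE.
Qed.

Lemma Rintegral_tail (X : {RV P >-> R}) (K e : R) :
  (P [set t | (K < `|X t|)%R] <= e%:E)%E ->
  P.-integrable setT (EFin \o (fun t => (K < `|X t|)%R%:R : R)) /\
  \int[P]_t ((K < `|X t|)%R%:R : R) <= e.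
Proof.
set A := [set t | _] => PA.
have mA : measurable A.
  have mn : measurable_fun setT (fun t => `|X t|) by exact: measurableT_comp.
  have := mn measurableT _ (measurable_itv `]K, +oo[); rewrite setTI.
  by congr measurable; apply/seteqP; split => t; rewrite /A/= in_itv/= andbT.
have E : (fun t => (K < `|X t|)%R%:R : R) = \1_A.
  apply/funext => t; rewrite indicE; congr (nat_of_bool _)%:R; apply/idP/idP.
    by move=> h; rewrite inE.
  by rewrite inE.
rewrite E; split; first exact: integrable_indic.
rewrite /Rintegral integral_indic// setIT -lee_fin fineK//; exact: fin_num_measure.
Qed.

(** At most [2D] edges touch a given edge, each involving three weights: hence
    the factor 6. *)
Lemma mean_gibbs_variance_ge D (K e : R) : 0 <= K -> 0 <= e ->
  (forall x : G, (degree x <= D)%N) ->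
  (forall a, (P [set t | (K < `|w a t|)%R] <= e%:E)%E) ->
  (forall x, (P [set t | (K < `|nu x t|)%R] <= e%:E)%E) ->
  variance_constant D K * (N * (1 - 6 * D%:R * e)) <=
  \int[P]_t gibbs_covariance (weights t) (fields t) card card.
Proof.
move=> K0 e0 hD tw tnu.
have ic : P.-integrable setT
    (EFin \o (fun t => gibbs_covariance (weights t) (fields t) card card)).
  apply: (@integrable_bounded _ _ _ P (N * N + N * N)).
    exact: (measurable_gibbs_covariance mwP mnuP).
  move=> t; apply: le_trans (ler_normB _ _) _; apply: lerD.
    by apply: gibbs_norm_le => M; rewrite normrM; apply: ler_pM.
  by rewrite normrM; apply: ler_pM => //; exact: gibbs_norm_le.
have iw a := Rintegral_tail (tw a).
have inu x := Rintegral_tail (tnu x).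
pose tail b t : R := (K < `|w b t|)%R%:R + \sum_(x in val b) (K < `|nu x t|)%R%:R.
have itail b : P.-integrable setT (EFin \o tail b).
  apply: integrable_add; first by have [] := iw b.
  by apply: integrable_sumr => x; have [] := inu x.
have Etail b : \int[P]_t tail b t <= 3 * e.
  rewrite /tail RintegralD//; last 2 first.
    by have [] := iw b.
    by apply: integrable_sumr => x; have [] := inu x.
  rewrite Rintegral_sum; last by move=> x; have [] := inu x.
  have -> : 3 * e = e + 2 * e by ring.
  apply: lerD; first by have [] := iw b.
  apply: (@le_trans _ _ (\sum_(x in val b) e)).
    by apply: ler_sum => x _; have [] := inu x.
  rewrite sumr_const -[leLHS]mulr_natl ler_wpM2r//.
  have [x [y [_ ->]]] := edgeP b.
  by rewrite cards2 ler_nat; case: (_ != _).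
have i1 : P.-integrable setT (EFin \o (fun _ : T => 1 : R)).
  exact: finite_measure_integrable_cst.
have it a : P.-integrable setT (EFin \o (fun t => \sum_(b | touching a b) tail b t)).
  exact: integrable_sumr.
have is_ : P.-integrable setT (EFin \o (fun t => \sum_a (1 - \sum_(b | touching a b) tail b t))).
  by apply: integrable_sumr => a; apply: integrable_sub.
apply: (@le_trans _ _ (\int[P]_t (variance_constant D K *
   (\sum_a (1 - \sum_(b | touching a b) tail b t))))); last first.
  apply: le_Rintegral => //; first exact: integrable_scale.
  by move=> t _; exact: gibbs_variance_truncated.
rewrite RintegralZl//; apply: ler_wpM2l.
  by rewrite !mulr_ge0 ?invr_ge0 ?addr_ge0 ?mulr_ge0 ?invr_ge0 ?exprn_ge0 ?expR_ge0.
rewrite Rintegral_sum; last by move=> a; exact: integrable_sub.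
rewrite mulr_natl -sumr_const; apply: ler_sum => a _.
have PT : fine (P setT) = 1 by rewrite probability_setT.
rewrite RintegralB// Rintegral_cst// mul1r; apply: lerB; first by rewrite PT.
rewrite Rintegral_sum//.
apply: le_trans (ler_sum _ (fun b _ => Etail b)) _.
rewrite sumr_const -[leLHS]mulr_natl.
have -> : 6 * D%:R * e = (D.*2)%:R * (3 * e) by rewrite -muln2 natrM; ring.
apply: ler_wpM2r; first by rewrite mulr_ge0.
by rewrite ler_nat -cardsE; exact: card_touching.
Qed.

End monomer_dimer.

Theorem proposition1p5 (R : realType) (D : nat) (rho : probability R R) :
  exists c : R, 0 < c /\
    forall (G : sgraph) (d : measure_display) (T : measurableType d)
      (P : probability T R)
      (w : edge G -> {RV P >-> R}) (nu : G -> {RV P >-> R}),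
      (forall x : G, (degree x <= D)%N) ->
      iid w (normal_prob 0 1) ->
      iid nu rho ->
      independent_families w nu ->
      ((c * #|edge_set G|%:R)%:E <=
        'V_P[fun t : T =>
          gibbs_expectation (fun a => w a t) (fun x => nu x t)
            (fun M => #|M|%:R)])%E.
Proof.
(* The factor 1 - 6 * D * e of mean_gibbs_variance_ge is then at least 1/2. *)
pose e : R := (12 * D%:R + 1)^-1.
have e1 : 0 < 12 * D%:R + 1 :> R by rewrite ltr_wpDl// mulr_ge0.
have e0 : 0 < e by rewrite invr_gt0.
have De : 6 * D%:R * e <= 2^-1.
  by rewrite /e ler_pdivrMr//; lra.
have [n1 h1] := @small_tail _ _ _ (normal_prob 0 1) (fun x : R => x) e
  (@measurable_id _ _ setT) e0.
have [n2 h2] := @small_tail _ _ _ rho (fun x : R => x) e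
  (@measurable_id _ _ setT) e0.
pose n := maxn n1 n2; pose K : R := n%:R.
pose m2 : R := normal_second_moment R.
have m20 : 0 <= m2 by apply: Rintegral_ge0 => x _; exact: sqr_ge0.
have m21 : 0 < m2 + 1 by rewrite ltr_wpDl.
pose v : R := variance_constant D K.
have v0 : 0 < v.
  by rewrite !mulr_gt0 ?invr_gt0 ?addr_gt0 ?exprn_gt0 ?expR_gt0 ?ltr0n.
pose c2 : R := v / 2.
have c20 : 0 < c2 by rewrite divr_gt0.
exists (c2 ^+ 2 / (m2 + 1)); split; first by rewrite divr_gt0// exprn_gt0.
move=> G d T P w nu hD iidw iidnu indwnu.
have -> : #|edge_set G| = #|{: edge G}|.
  by rewrite card_sig; apply: eq_card => A; rewrite inE.
set N : R := _%:R.
have mtail : measurable [set x : R | K < `|x|].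
  have mn : measurable_fun setT (fun x : R => `|x|) by exact: measurableT_comp.
  have := mn measurableT _ (measurable_itv `]K, +oo[); rewrite setTI.
  by congr measurable; apply/seteqP; split => t; rewrite /= in_itv/= andbT.
have tw a : (P [set t | (K < `|w a t|)%R] <= e%:E)%E.
  have := iidw.2 a _ mtail; rewrite /distribution /pushforward /= => ->.
  by apply: h1; exact: leq_maxl.
have tnu x : (P [set t | (K < `|nu x t|)%R] <= e%:E)%E.
  have := iidnu.2 x _ mtail; rewrite /distribution /pushforward /= => ->.
  by apply: h2; exact: leq_maxr.
have := mean_gibbs_variance_ge (ler0n _ n) (ltW e0) hD tw tnu.
rewrite -/K -/v; set V := Rintegral _ _ _ => hV.
have NV : N * c2 <= V.
  apply: le_trans hV; rewrite /c2 mulrA [v * (_ * _)]mulrCA -mulrA.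
  by apply: ler_wpM2l => //; apply: ler_wpM2l; [exact: ltW|lra].
(* Nearly optimal in the quadratic bound of variance_mean_size_ge. *)
pose l := c2 / (m2 + 1).
have l0 : 0 < l by rewrite divr_gt0.
apply: le_trans (variance_mean_size_ge iidw indwnu l); rewrite lee_fin -/V -/m2 -/N.
have N0 : 0 <= N by [].
have lm : l * (m2 + 1) = c2 by rewrite divfK// gt_eqF.
have -> : c2 ^+ 2 / (m2 + 1) = l * c2 by rewrite /l expr2 mulrAC.
have h3 : 2 * l * (N * c2) <= 2 * l * V by apply: ler_wpM2l => //; rewrite mulr_ge0// ltW.
have h4 : l ^+ 2 * (N * m2) <= l * N * c2.
  rewrite -lm; have -> : l ^+ 2 * (N * m2) = l * N * (l * m2) by ring.
  apply: ler_wpM2l; first by rewrite mulr_ge0// ltW.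
  by apply: ler_wpM2l; [exact: ltW|rewrite lerDl].
lra.
Qed.
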